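(* Suppose that $\chi=(P,Q,R)$ is a vector field on $\mathbb{T}^2$ such that $P,Q,R\in\mathbb{R}[x,y,z]$ are homogeneous polynomials with $\deg P=\deg Q=n$ and $\deg R\leq n$. Then $R=0$.
   Context: Fix a real number $a>1$ and let $\mathbb{T}^2=\{(x,y,z)\in\mathbb{R}^3:(x^2+y^2-a^2)^2+z^2-1=0\}$. A triple $\chi=(P,Q,R)$ with $P,Q,R\in\mathbb{R}[x,y,z]$ denotes the polynomial vector field $P\frac{\partial}{\partial x}+Q\frac{\partial}{\partial y}+R\frac{\partial}{\partial z}$ in $\mathbb{R}^3$, acting on polynomials as a derivation. It is called a vector field on $\mathbb{T}^2$ if $\chi F=KF$ for some $K\in\mathbb{R}[x,y,z]$, where $F=(x^2+y^2-a^2)^2+z^2-1$. *)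

(* Defs.v *)
From mathcomp Require Import all_boot all_order all_algebra.
From mathcomp Require Import reals.
From mathcomp.multinomials Require Import mpoly.

Set Implicit Arguments.
Unset Strict Implicit.
Unset Printing Implicit Defensive.

Import GRing.Theory.
Local Open Scope ring_scope.

Section TorusVectorFields.
Variable R : realType.
Implicit Types (a : R) (A B C f : {mpoly R[3]}).

Definition cx : 'I_3 := @Ordinal 3 0 isT.
Definition cy : 'I_3 := @Ordinal 3 1 isT.
Definition cz : 'I_3 := @Ordinal 3 2 isT.

Definition torus_poly a : {mpoly R[3]} :=
  ('X_cx ^+ 2 + 'X_cy ^+ 2 - (a ^+ 2)%:MP) ^+ 2 + 'X_cz ^+ 2 - 1.

Definition vf_act A B C f : {mpoly R[3]} :=
  A * mderiv cx f + B * mderiv cy f + C * mderiv cz f.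

(* The components of a vector field are A, B, C since R is the real field;
   K is the cofactor witnessing that the torus is invariant. *)
Definition vf_on_torus a A B C : Prop :=
  exists K : {mpoly R[3]}, vf_act A B C (torus_poly a) = K * torus_poly a.

End TorusVectorFields.

(* Main.v *)
Require Import Defs.
From mathcomp Require Import all_boot all_order all_algebra.
From mathcomp Require Import reals ring lra.
From mathcomp.multinomials Require Import mpoly.

Set Implicit Arguments.
Unset Strict Implicit.
Unset Printing Implicit Defensive.

Import Order.TTheory GRing.Theory Num.Theory.
Local Open Scope ring_scope.

(* Write S = x A + y B. If p = (x, y, z) satisfies a^2 z^2 < x^2 + y^2, the ray
   through p meets the torus at two points t1 p and t2 p, one inside and one
   outside the cylinder x^2 + y^2 = a^2. By homogeneity, tangency at ti p reads
     4 (ti^2 (x^2 + y^2) - a^2) ti^(n+1) S(p) + 2 ti^(m+1) z C(p) = 0,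
   and the coefficient of S(p) changes sign from t1 to t2 while that of z C(p)
   does not. Hence z C(p) = 0, so C vanishes on an infinite grid and C = 0. *)

Lemma meval_dhomog (R : comNzRingType) (k d : nat) (p : {mpoly R[k]})
    (v : 'I_k -> R) (t : R) :
  p \is d.-homog -> p.@[fun i => t * v i] = t ^+ d * p.@[v].
Proof.
move=> /dhomogP hp; rewrite !mevalE mulr_sumr; apply: eq_big_seq => m /hp <-.
under eq_bigr do rewrite exprMn.
by rewrite big_split /= prodrXr mdegE mulrCA.
Qed.

(** Substituting the last variable back inverts [muni]; hence [muni p = 0] forces [p = 0]. *)
Lemma muniK (R : comNzRingType) (k : nat) (p : {mpoly R[k.+1]}) :
  (map_poly (@mwiden k R) (muni p)).['X_ord_max] = p.
Proof.
rewrite muniE [RHS]mpolyE raddf_sum /= horner_sum; apply: eq_bigr => m _.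
rewrite -!mul_polyC !rmorphM /= !map_polyC /= map_polyXn !hornerE.
rewrite mwidenZ mwidenX -scalerAl; congr (_ *: _).
rewrite [RHS]mpolyXE_id big_ord_recr /=; congr (_ * _).
rewrite mpolyXE_id big_ord_recr /= mnmwiden_ordmax expr0 mulr1.
by apply: eq_bigr => i _; rewrite mnmwiden_widen mnmE.
Qed.

Lemma meval_muni (R : comNzRingType) (k : nat) (p : {mpoly R[k.+1]})
    (v : 'I_k.+1 -> R) :
  p.@[v] =
    (map_poly (meval (fun i => v (widen_ord (leqnSn k) i))) (muni p)).[v ord_max].
Proof.
rewrite mevalE muniE raddf_sum /= horner_sum; apply: eq_bigr => m _.
rewrite -!mul_polyC !rmorphM /= !map_polyC /= map_polyXn !hornerE.
rewrite mevalZ mevalX -mulrA big_ord_recr /=; congr (_ * (_ * _)).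
by apply: eq_bigr => i _; rewrite mnmE.
Qed.

Lemma poly_eq0_inj (R : idomainType) (f : nat -> R) (q : {poly R}) :
  injective f -> (forall j, q.[f j] = 0) -> q = 0.
Proof.
move=> fI q0; apply/eqP/negPn/negP => /max_poly_roots.
move=> /(_ (mkseq f (size q)) _ _); rewrite size_mkseq ltnn => h.
suff // : false by [].
by apply: h; [apply/allP => _ /mapP[j _ ->]; apply/rootP | apply: mkseq_uniq].
Qed.

(** Induction on the number of variables. Freezing all coordinates but the last leaves a univariate
    polynomial with infinitely many roots, so each coefficient of [muni p] vanishes on the smaller
    grid and is zero by induction. *)
Lemma mpoly_eq0_grid (R : idomainType) (k : nat) (p : {mpoly R[k]})
    (f : 'I_k -> nat -> R) :
  (forall i, injective (f i)) ->
  (forall c : 'I_k -> nat, p.@[fun i => f i (c i)] = 0) -> p = 0.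
Proof.
elim: k p f => [|k IH] p f fI p0.
  by have := p0 (fun=> 0%N); rewrite (nvar0_mpolyC p) mevalC => ->.
suff mp0 : muni p = 0 by rewrite -(muniK p) mp0 rmorph0 horner0.
apply/polyP => d; rewrite coef0.
apply: (IH _ (fun i => f (widen_ord (leqnSn k) i))) => [i|c]; first exact: fI.
set ev := meval _.
have q0 : map_poly ev (muni p) = 0.
  apply: (poly_eq0_inj (fI ord_max)) => j.
  (* Extends the grid index [c] by [j]: [insub] fails exactly at [ord_max]. *)
  pose c' (i : 'I_k.+1) := if insub (i : nat) is Some i' then c i' else j.
  have := p0 c'; rewrite meval_muni.
  rewrite {2}/c' insubF ?ltnn //= => qj; rewrite -[RHS]qj; congr (_.[_]).
  apply: eq_map_poly => r; apply: meval_eq => i; rewrite /c' /=.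
  by rewrite insubT //= => lt_ik; congr (f _ (c _)); apply: val_inj.
by have := congr1 (fun q : {poly R} => q`_d) q0; rewrite coef_map coef0.
Qed.

(** With [u] = x^2 + y^2 and [w] = z^2, the torus polynomial along the ray is positive at t = 0,
    negative where the ray crosses the cylinder, and positive again at twice that parameter. The
    intermediate value theorem gives a root on each side. *)
Lemma ray_meets_torus (R : rcfType) (a u w : R) :
    1 < a -> 0 < u -> 0 <= w -> a ^+ 2 * w < u ->
  exists t1 t2 : R,
   [/\ 0 < t1, 0 < t2, t1 ^+ 2 * u < a ^+ 2, a ^+ 2 < t2 ^+ 2 * u
     & forall t, t \in [:: t1; t2] ->
       (t ^+ 2 * u - a ^+ 2) ^+ 2 + t ^+ 2 * w - 1 = 0].
Proof.
move=> a1 u0 w0 wu.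
pose G : {poly R} := ('X ^+ 2 * u%:P - (a ^+ 2)%:P) ^+ 2 + 'X ^+ 2 * w%:P - 1.
have GE t : G.[t] = (t ^+ 2 * u - a ^+ 2) ^+ 2 + t ^+ 2 * w - 1.
  by rewrite /G !hornerE.
have [s s0 s2] : exists2 s : R, 0 < s & s ^+ 2 * u = a ^+ 2.
  exists (a / Num.sqrt u); first by rewrite divr_gt0 ?sqrtr_gt0 //; lra.
  by rewrite expr_div_n sqr_sqrtr ?ltW // divfK ?gt_eqF.
(* At the cylinder the square vanishes, leaving s^2 w - 1; multiplied by [u], its negativity is a^2
   w < u. *)
have Gs : G.[s] < 0.
  rewrite GE s2 subrr expr0n /= add0r subr_lt0.
  by rewrite -(ltr_pM2r u0) mul1r mulrAC s2.
have a2 : 1 < a ^+ 2 by rewrite exprn_egt1 // ltW.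
have G0 : 0 < G.[0].
  by rewrite GE expr0n /= !mul0r sub0r addr0 sqrrN subr_gt0 exprn_egt1 // ltW.
(* The square is now (4 a^2 - a^2)^2 = 9 a^4 > 1. *)
have G2 : 0 < G.[2 * s].
  rewrite GE (_ : (2 * s) ^+ 2 * u = 4 * a ^+ 2); last by rewrite -s2; ring.
  have := mulr_ge0 (sqr_ge0 (2 * s)) w0; nra.
have [t1 /andP[t10 t1s] /rootP] : exists2 t, 0 <= t <= s & root (- G) t.
  by apply: poly_ivt; rewrite ?(ltW s0) // !hornerN oppr_le0 oppr_ge0 !ltW.
have [t2 /andP[st2 _] /rootP Gt2] : exists2 t, s <= t <= 2 * s & root G t.
  by apply: poly_ivt; rewrite ?(ltW Gs) ?(ltW G2) //; lra.
rewrite hornerN => /eqP; rewrite oppr_eq0 => /eqP Gt1.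
(* The roots avoid the interval endpoints 0 and [s], where [G] is nonzero, so the bounds are
   strict. *)
have t1p : 0 < t1.
  by rewrite lt_def t10 andbT; apply/eqP => t1z; move: G0; rewrite -[X in G.[X]]t1z Gt1 ltxx.
have t1lt : t1 < s.
  by rewrite lt_def t1s andbT; apply/eqP => ts; move: Gs; rewrite ts Gt1 ltxx.
have t2gt : s < t2.
  by rewrite lt_def st2 andbT; apply/eqP => ts; move: Gs; rewrite -ts Gt2 ltxx.
exists t1, t2; split=> //.
- exact: lt_trans t2gt.
- by rewrite -s2 ltr_pM2r // ltr_pXn2r // nnegrE ltW.
- by rewrite -s2 ltr_pM2r // ltr_pXn2r // nnegrE ltW // (lt_trans s0).
- by move=> t; rewrite !inE => /orP[] /eqP ->; rewrite -GE.
Qed.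

Lemma meval_torus_poly (R : realType) (a : R) (v : 'I_3 -> R) :
  (torus_poly a).@[v] =
    (v cx ^+ 2 + v cy ^+ 2 - a ^+ 2) ^+ 2 + v cz ^+ 2 - 1.
Proof.
rewrite /torus_poly !expr2.
by rewrite !(mevalB, mevalD, mevalM, mevalXU, mevalC, meval1).
Qed.

Lemma vf_act_torus_poly (R : realType) (a : R) (A B C : {mpoly R[3]}) :
  vf_act A B C (torus_poly a) =
    4 * ('X_cx ^+ 2 + 'X_cy ^+ 2 - (a ^+ 2)%:MP) * ('X_cx * A + 'X_cy * B)
    + 2 * ('X_cz * C).
Proof.
rewrite /vf_act /torus_poly -mpolyC1 !expr2.
rewrite !(mderivB, mderivD, mderivM, mderivC, mderivX) !mnm1E /=.
rewrite !scale0r !scale1r.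
have U0 i : 'X_[U_(i) - U_(i)] = 1 :> {mpoly R[3]}.
  by rewrite (_ : (_ - _)%MM = 0%MM) ?mpolyX0 //;
    apply/mnmP => j; rewrite mnmBE subnn mnmE.
by rewrite !U0; ring.
Qed.

Theorem proposition1p1 (R : realType) (a : R) (ha : 1 < a) (n m : nat)
  (A B C : {mpoly R[3]})
  (hA : A \is n.-homog) (hB : B \is n.-homog)
  (hC : C \is m.-homog) (hmn : (m <= n)%N)
  (hvf : vf_on_torus a A B C) :
  C = 0.
Proof.
(* Grid points have x, y > a and 0 < z <= 1, so a^2 z^2 <= a^2 < x^2 + y^2 and z can be cancelled at
   the end. *)
pose f (i : 'I_3) (k : nat) : R :=
  if i == cz then k.+1%:R^-1 else a + k.+1%:R.
apply: (@mpoly_eq0_grid _ _ C f) => [i j k|c].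
  rewrite /f; case: ifP => _.
    by move/invr_inj/eqP; rewrite eqr_nat => /eqP[].
  by move/addrI/eqP; rewrite eqr_nat => /eqP[].
set v := fun i => _.
have vx : a < v cx by rewrite /v /f /= ltrDl ltr0n.
have vy : a < v cy by rewrite /v /f /= ltrDl ltr0n.
have vz0 : 0 < v cz by rewrite /v /f /= invr_gt0 ltr0n.
have vz1 : v cz <= 1 by rewrite /v /f /= invf_le1 ?ltr0n // ler1n.
move: v vx vy vz0 vz1 => v vx vy vz0 vz1.
pose S := v cx * A.@[v] + v cy * B.@[v].
have [|||t1 [t2 [t10 t20 t1u t2u on_torus]]] :=
  @ray_meets_torus _ a (v cx ^+ 2 + v cy ^+ 2) (v cz ^+ 2) ha.
- by rewrite ltr_wpDr ?sqr_ge0 ?exprn_gt0 //; lra.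
- exact: sqr_ge0.
- apply: (@le_lt_trans _ _ (a ^+ 2)).
    by rewrite ler_piMr ?sqr_ge0 // exprn_ile1 // ltW.
  by rewrite ltr_wpDr ?sqr_ge0 // ltrXn2r //=; lra.
(* The cofactor term dies because t p lies on the torus. Each exponent is the degree of the
   component plus one, from the coordinate multiplying it. *)
have key t : t \in [:: t1; t2] ->
    4 * (t ^+ 2 * (v cx ^+ 2 + v cy ^+ 2) - a ^+ 2) * t ^+ n.+1 * S
    + 2 * t ^+ m.+1 * (v cz * C.@[v]) = 0.
  move=> /on_torus F0; case: hvf => K /(congr1 (meval (fun i => t * v i))).
  rewrite mevalM meval_torus_poly vf_act_torus_poly.
  have -> : ((t * v cx) ^+ 2 + (t * v cy) ^+ 2 - a ^+ 2) ^+ 2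
      + (t * v cz) ^+ 2 - 1 = 0.
    by rewrite -[RHS]F0; ring.
  rewrite mulr0 !expr2 -![_%:R in LHS]mpolyC_nat.
  rewrite !(mevalB, mevalD, mevalM, mevalXU, mevalC).
  rewrite (meval_dhomog _ _ hA) (meval_dhomog _ _ hB) (meval_dhomog _ _ hC) => E0.
  by rewrite -[RHS]E0 /S !exprS; ring.
have := key t1 _; have := key t2 _; rewrite !inE !eqxx orbT => /(_ isT) k2 /(_ isT) k1.
move: k1 k2.
set e1 := t1 ^+ n.+1; set e2 := t2 ^+ n.+1.
set d1 := t1 ^+ m.+1; set d2 := t2 ^+ m.+1.
have [e1p e2p d1p d2p] : [/\ 0 < e1, 0 < e2, 0 < d1 & 0 < d2].
  by rewrite /e1 /e2 /d1 /d2 !exprn_gt0.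
set x1 := _ - _; set x2 := (_ * _ - _).
have x1n : x1 < 0 by rewrite subr_lt0.
have x2p : 0 < x2 by rewrite subr_gt0.
set T := v cz * _ => k1 k2.
(* Up to a constant factor, this is the determinant of the linear system [k1], [k2] in [S] and [T].
   Eliminating [T] leaves four times it as the coefficient of [S]. *)
have coef_lt0 : d2 * e1 * x1 - d1 * e2 * x2 < 0.
  by rewrite subr_lt0 (@lt_trans _ _ 0) ?pmulr_rgt0 ?pmulr_rlt0 ?mulr_gt0.
have S0 : S = 0.
  apply: (mulfI (ltr0_neq0 coef_lt0)); rewrite mulr0.
  apply: (@mulfI _ 4); first by rewrite pnatr_eq0.
  transitivity (d2 * (4 * x1 * e1 * S + 2 * d1 * T)
    - d1 * (4 * x2 * e2 * S + 2 * d2 * T)); first by ring.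
  by rewrite k1 k2 !mulr0 subr0.
move: k1; rewrite S0 mulr0 add0r => /eqP.
by rewrite !mulf_eq0 pnatr_eq0 (gt_eqF d1p) (gt_eqF vz0) => /eqP.
Qed.
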